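(* Let $n\geq 2$ and let $a_1,\dots,a_n$ be positive integers with $\gcd(a_1,a_2)=d\neq 1$. Put $a'_i=\frac{a_i}{d}$ for $i=1,2$. Then, for every positive integer $k$, the equation $$\sum_{i=1}^{n}a_ix_i=b$$ is solvable in non-negative integers $x_1,\dots,x_n$ for $$b=\bigl(a'_1a'_2-(a'_1+a'_2)+k\bigr)d.$$ In particular, if $d=2$, then this equation is solvable in non-negative integers for every even integer $b$ with $$b>2\bigl(a'_1a'_2-(a'_1+a'_2)\bigr).$$ *)

(* Defs.v *)
From mathcomp Require Import all_boot all_order all_algebra.

Set Implicit Arguments.
Unset Strict Implicit.
Unset Printing Implicit Defensive.

Import Order.TTheory GRing.Theory Num.Theory.
Local Open Scope ring_scope.

(* The right-hand side ranges over [int]: expressions such as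
   a1 * a2 - (a1 + a2) can be negative, so truncated [nat] subtraction would
   be wrong. *)
Definition nneg_solvable (n : nat) (a : 'I_n -> nat) (b : int) : Prop :=
  exists x : 'I_n -> nat, \sum_(i < n) (a i)%:Z * (x i)%:Z = b.

(* Main.v *)
Require Import Defs.
From mathcomp Require Import all_boot all_order all_algebra.
From mathcomp Require Import zify ring.

Set Implicit Arguments.
Unset Strict Implicit.
Unset Printing Implicit Defensive.

Import Order.TTheory GRing.Theory Num.Theory.
Local Open Scope ring_scope.

(** Only the first two coefficients matter: with all other unknowns set to 0,
    and after division by [d = gcd (a1, a2)], the equation becomes
    [a1' x + a2' y = m] with [a1'] and [a2'] coprime.  Sylvester's theorem on
    the Frobenius number of two coprime integers ([sylvester_two_coins]) says
    that this is solvable as soon as [m] exceeds [a1' a2' - (a1' + a2')].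
    Both claims are instances: [m] is the Frobenius number plus [k] in the
    first, and [b / 2] in the second. *)

(** By Bezout, [p x = m] can be solved modulo [q], with a representative
    [x <= q - 1].  Then [m - p x] is a multiple of [q], and the bound on [m]
    makes it larger than [- q], so it is a nonnegative multiple. *)
Lemma sylvester_two_coins (p q : nat) (m : int) :
  (0 < q)%N -> coprime p q ->
  p%:Z * q%:Z - (p%:Z + q%:Z) < m ->
  exists x y : nat, p%:Z * x%:Z + q%:Z * y%:Z = m.
Proof.
move=> q_gt0 co_pq m_gt.
have /coprimezP[[u v] /= uvE] : coprimez p q by [].
pose x : int := ((m * u) %% q)%Z.
pose y : int := m * v + p%:Z * ((m * u) %/ q)%Z.
have x_ge0 : 0 <= x by apply: modz_ge0; lia.
have x_lt : x < q%:Z by apply: ltz_pmod.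
have xyE : p%:Z * x + q%:Z * y = m.
  have muE := divz_eq (m * u) q; rewrite -/x in muE.
  have -> : x = m * u - ((m * u) %/ q)%Z * q%:Z by rewrite {1}muE; ring.
  by rewrite /y -[RHS]mulr1 -uvE; ring.
(* [p x <= p (q - 1)] gives [q y = m - p x > - q]. *)
have y_ge0 : 0 <= y by nia.
by exists `|x|%N, `|y|%N; rewrite !gez0_abs.
Qed.

Lemma nneg_solvable_first_two (n : nat) (hn : (1 < n)%N) (a : 'I_n -> nat)
    (x y : nat) :
  nneg_solvable a ((a (Ordinal (ltnW hn)))%:Z * x%:Z
                   + (a (Ordinal hn))%:Z * y%:Z).
Proof.
exists (fun i : 'I_n => if val i is j.+1 then if j is _.+1 then 0%N else y else x).
rewrite (bigD1 (Ordinal (ltnW hn))) //= (bigD1 (Ordinal hn)) //=.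
by rewrite big1 ?addr0 // => -[[|[|j]] ltjn] //=; rewrite mulr0.
Qed.

(** This puts both claims in a common form: dividing by [d] makes the first two
    coefficients coprime, so that the two-coin theorem applies to [m]. *)
Lemma nneg_solvable_mul_gcd (n : nat) (hn : (1 < n)%N) (a : 'I_n -> nat)
    (d : nat) (m : int) :
  let a1 := a (Ordinal (ltnW hn)) in
  let a2 := a (Ordinal hn) in
  (0 < a2)%N -> gcdn a1 a2 = d ->
  (a1 %/ d)%N%:Z * (a2 %/ d)%N%:Z - ((a1 %/ d)%N%:Z + (a2 %/ d)%N%:Z) < m ->
  nneg_solvable a (m * d%:Z).
Proof.
move=> a1 a2 a2_gt0 gcdE m_gt.
have d_gt0 : (0 < d)%N by rewrite -gcdE gcdn_gt0 a2_gt0 orbT.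
have d_dvd1 : (d %| a1)%N by rewrite -gcdE dvdn_gcdl.
have d_dvd2 : (d %| a2)%N by rewrite -gcdE dvdn_gcdr.
have q_gt0 : (0 < a2 %/ d)%N by rewrite divn_gt0 // dvdn_leq.
have co : coprime (a1 %/ d) (a2 %/ d).
  by rewrite /coprime -(eqn_pmul2r d_gt0) muln_gcdl !divnK // gcdE mul1n.
have [x [y <-]] := sylvester_two_coins q_gt0 co m_gt.
have -> : ((a1 %/ d)%N%:Z * x%:Z + (a2 %/ d)%N%:Z * y%:Z) * d%:Z
          = a1%:Z * x%:Z + a2%:Z * y%:Z.
  rewrite -{2}(divnK d_dvd1) -{2}(divnK d_dvd2) !PoszM; ring.
exact: nneg_solvable_first_two.
Qed.

Theorem theorem2p18 (n : nat) (hn : (1 < n)%N) (a : 'I_n -> nat)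
    (ha : forall i : 'I_n, (0 < a i)%N) (d : nat) :
  let a1 : nat := a (Ordinal (ltnW hn)) in
  let a2 : nat := a (Ordinal hn) in
  gcdn a1 a2 = d -> d <> 1%N ->
  let a1' : int := (a1 %/ d)%N%:Z in
  let a2' : int := (a2 %/ d)%N%:Z in
  (forall k : nat, (0 < k)%N ->
     nneg_solvable a ((a1' * a2' - (a1' + a2') + k%:Z) * d%:Z))
  /\ (d = 2%N ->
      forall b : int, (2 %| b)%Z -> 2 * (a1' * a2' - (a1' + a2')) < b ->
        nneg_solvable a b).
Proof.
move=> a1 a2 gcdE _ a1' a2'; split=> [k k_gt0|d2 b /dvdzP[m ->] m_gt].
  by apply: nneg_solvable_mul_gcd => //; rewrite ltrDl ltz_nat.
have -> : m * 2 = m * d%:Z by rewrite d2.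
apply: nneg_solvable_mul_gcd => //.
by rewrite mulrC ltr_pM2r // in m_gt.
Qed.
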